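(* Let $\Gamma$ be a countable discrete group and $\mu$ a symmetric probability measure on $\Gamma$. Let $T\in\mathcal B(\ell^2(\Gamma))$ satisfy $\mathcal P_\mu(\mathcal P^o_\mu(T))=T$. Then $T$ can be written uniquely as $T=T_0+T_1$ where $\mathcal P_\mu(T_0)=\mathcal P^o_\mu(T_0)=T_0$ and $\mathcal P_\mu(T_1)=\mathcal P^o_\mu(T_1)=-T_1$.
   Context: $\lambda$ and $\rho$ denote the left and right regular representations of $\Gamma$ on $\ell^2(\Gamma)$: $\lambda_g\delta_x=\delta_{gx}$, $\rho_g\delta_x=\delta_{xg^{-1}}$. Define on $\mathcal B(\ell^2(\Gamma))$: $\mathcal P_\mu(T)=\sum_g\mu(g)\rho_gT\rho_g^*$ and $\mathcal P^o_\mu(T)=\sum_g\mu(g)\lambda_g^*T\lambda_g$. $\mu$ symmetric means $\mu(g)=\mu(g^{-1})$ for all $g$. *)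

(* Defs.v *)
From HB Require Import structures.
From mathcomp Require Import all_boot all_order all_algebra.
From mathcomp Require Export complex.
From mathcomp Require Import all_classical all_reals all_analysis.
Set Implicit Arguments. Unset Strict Implicit. Unset Printing Implicit Defensive.
Import Order.TTheory GRing.Theory Num.Theory.
Import numFieldNormedType.Exports.
Local Open Scope ring_scope.
Local Open Scope classical_set_scope.

HB.structure Definition CountGroup := {G of monoid.Group G & Countable G}.
Notation countGroupType := CountGroup.type.

(* The complex numbers over the real field R, seen as a numClosedFieldType
   (so that MathComp-Analysis' topology/limits apply). *)
Definition CC (R : realType) : numClosedFieldType := R[i].

Section Defs.
Variables (R : realType) (G : countGroupType).
Local Notation C := (CC R).

(* Sum over the countable set G, along the enumeration of G given by its
   countable structure (pickle_inv n = Some g iff pickle g = n).  For absolutely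
   summable families (the only ones used below) this is the unconditional sum. *)
Definition gterm (f : G -> C) (n : nat) : C :=
  if @pickle_inv G n is Some g then f g else 0.
Definition gsum (f : G -> C) : C := lim (series (gterm f) @ \oo).
Definition rterm (f : G -> R) (n : nat) : R :=
  if @pickle_inv G n is Some g then f g else 0.

Definition symmetric_prob (mu : G -> R) : Prop :=
  (forall g, 0 <= mu g) /\ (series (rterm mu) @ \oo --> (1 : R)) /\
  (forall g, mu g = mu (g^-1)%g).

(* Operators on l^2(G) are represented by their matrices
   T x y = < T delta_y , delta_x >. *)
Definition opmat := G -> G -> C.

(* T is (the matrix of) a bounded operator on l^2(G): there is C >= 0 with
   |<u, T v>| <= C ||u|| ||v|| for all finitely supported u, v. *)
Definition bounded_op (T : opmat) : Prop :=
  exists c : C, 0 <= c /\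
   forall (s : seq G) (u v : G -> C), uniq s ->
     `| \sum_(x <- s) \sum_(y <- s) (u x)^* * T x y * v y | ^+ 2
       <= c ^+ 2 * (\sum_(x <- s) `|u x| ^+ 2) * (\sum_(y <- s) `|v y| ^+ 2).

(* P_mu(T) = sum_g mu(g) rho_g T rho_g^*, whose matrix is
   (x,y) |-> sum_g mu(g) T(xg, yg). *)
Definition Pmu (mu : G -> R) (T : opmat) : opmat :=
  fun x y => gsum (fun g => ((mu g)%:C)%C * T (x * g)%g (y * g)%g).

(* P^o_mu(T) = sum_g mu(g) lambda_g^* T lambda_g, whose matrix is
   (x,y) |-> sum_g mu(g) T(gx, gy). *)
Definition Pomu (mu : G -> R) (T : opmat) : opmat :=
  fun x y => gsum (fun g => ((mu g)%:C)%C * T (g * x)%g (g * y)%g).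

End Defs.

(* Main.v *)
(* Write A = P_mu and B = P^o_mu; these are commuting averages over walks, acting
   on the bounded matrix entries of T, and A B T = T.  By symmetry of mu, A^2 is a
   proper mixture of the identity with another average.  Put T_n = B^(2n) T and
   D_n = T_n - T_(n+1), so that A^2 D_(n+1) = D_n.  If the supremum s of all entries
   of the D_n (taken on real or imaginary parts) were positive, then at an entry
   where some D_n is nearly s the mixture property forces D_(n+1), D_(n+2), ... to be
   nearly s there too, and the telescoping sum T_n - T_(n+k) would exceed
   any bound.  The same applied to -T gives B^2 T = T, hence A T = A B^2 T = B T and
   A^2 T = T, so that T_0 = (T + A T) / 2 and T_1 = (T - A T) / 2 is the
   decomposition; it is the only one since A T = T_0 - T_1 is forced. *)
Require Import Defs.
From HB Require Import structures.
From mathcomp Require Import all_boot all_order all_algebra.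
From mathcomp Require Import all_classical all_reals all_analysis.
From mathcomp Require Import lra ring.
Import Order.TTheory GRing.Theory Num.Theory.
Import numFieldNormedType.Exports.
Local Open Scope ring_scope.
Set Implicit Arguments. Unset Strict Implicit. Unset Printing Implicit Defensive.

(** * Bounded sequences of functions with a backward drift *)

(** The supremum [s] of all differences [D n x] is itself an admissible bound in the drift
    hypothesis, which then says [a * (s - D n.+1 x) <= s - D n x]. The gap below [s] thus grows by
    at most a factor [1 / a] per step, so a tiny initial gap stays small for as many steps as
    desired. *)
Lemma backward_drift_le0 (R : realType) (X : Type) (c a : R) (T : nat -> X -> R) :
  0 < a <= 1 -> (forall n x, `|T n x| <= c) ->
  (forall s, (forall n x, T n x - T n.+1 x <= s) -> forall n x,
     T n x - T n.+1 x <= a * (T n.+1 x - T n.+2 x) + (1 - a) * s) ->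
  forall n x, T n x <= T n.+1 x.
Proof.
move=> /andP[a0 a1] Tc drift n0 x0; rewrite -subr_le0 leNgt; apply/negP => D0.
pose D n x := T n x - T n.+1 x; pose E := [set D p.1 p.2 | p in @setT (nat * X)]%classic.
have Dc n x : D n x <= c *+ 2.
  by apply: le_trans (ler_norm _) (le_trans (ler_normB _ _) _); rewrite mulr2n lerD.
have Esup : has_sup E.
  by split; [exists (D n0 x0), (n0, x0) | exists (c *+ 2) => _ [p _ <-]].
have leE n x : D n x <= sup E by apply: sup_upper_bound => //; exists (n, x).
have s0 : 0 < sup E := lt_le_trans D0 (leE n0 x0).
set s := sup E in leE s0.
have c0 : 0 <= c := le_trans (normr_ge0 _) (Tc n0 x0).
(* This makes [k * (s / 2)] exceed [2 * c], the largest possible value of [T n x - T (n + k) x]. *)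
pose k := (Num.truncn (4 * c / s)).+1.
(* The margin is chosen so that, after growing by [1 / a] at each of [k] steps, the gap is still at
   most [s / 2]. *)
have [_ [[n x] _ <-] /= sD] : exists2 d, E d & s - a ^+ k * (s / 2) < d.
  by apply: sup_adherent => //; rewrite mulr_gt0 ?exprn_gt0 ?divr_gt0.
have near_sup i : (i <= k)%N -> a ^+ i * (s - D (n + i)%N x) <= a ^+ k * (s / 2).
  elim: i => [_|i IH lt_ik]; first by rewrite expr0 mul1r addn0; lra.
  apply: le_trans (IH (ltnW lt_ik)); rewrite exprSr -mulrA ler_wpM2l ?exprn_ge0 ?(ltW a0) //.
  by have := drift s leE (n + i)%N x; rewrite -/(D _ _) -/(D _ _) addnS; lra.
have half i : (i <= k)%N -> s / 2 <= D (n + i)%N x.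
  move=> ik; have ai : 0 < a ^+ i by rewrite exprn_gt0.
  suff : s - D (n + i)%N x <= s / 2 by lra.
  rewrite -(ler_pM2l ai); apply: le_trans (near_sup i ik) _.
  by rewrite ler_wpM2r ?divr_ge0 ?(ltW s0) // ler_wiXn2l // ltW.
have telescope j : (j <= k)%N -> j%:R * (s / 2) <= T n x - T (n + j)%N x.
  elim: j => [_|j IH lt_jk]; first by rewrite mul0r addn0 subrr.
  have := IH (ltnW lt_jk); have := half j (ltnW lt_jk).
  by rewrite /D -addnS -[in X in _ -> _ -> X * _ <= _]addn1 natrD; lra.
have kc : 4 * c / s < k%:R by exact: truncnS_gt.
rewrite ltr_pdivrMr // in kc.
have := telescope k (leqnn k).
have := Tc n x; have := Tc (n + k)%N x; rewrite !ler_norml => /andP[? ?] /andP[? ?].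
lra.
Qed.

(** * Means of bounded real functions against [mu] *)

Section Mean.
Variables (R : realType) (G : countGroupType) (mu : G -> R).

Definition mean (f : G -> R) : R := limn (series (rterm (fun g => mu g * f g))).

Hypothesis hmu : symmetric_prob mu.
Let mu_ge0 g : 0 <= mu g. Proof. by case: hmu. Qed.
Let mu_sum : (series (rterm mu) @ \oo --> (1 : R))%classic. Proof. by case: hmu => _ []. Qed.

Lemma rtermM_bound (f : G -> R) c n : (forall g, `|f g| <= c) ->
  `|rterm (fun g => mu g * f g) n| <= c * rterm mu n.
Proof.
move=> fc; rewrite /rterm; case: pickle_inv => [g|]; last by rewrite normr0 mulr0.
by rewrite normrM ger0_norm // mulrC ler_wpM2r.
Qed.

Lemma mean_cvg (f : G -> R) c : (forall g, `|f g| <= c) ->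
  (series (rterm (fun g => mu g * f g)) @ \oo --> mean f)%classic.
Proof.
move=> fc; apply: normed_cvg.
apply: (@series_le_cvg _ _ (fun n => c * rterm mu n)) => [n|n|n|].
- exact: normr_ge0.
- by apply: le_trans (normr_ge0 _) (rtermM_bound n fc).
- exact: rtermM_bound.
have -> : series (fun n => c * rterm mu n) = (fun n => c * series (rterm mu) n).
  by apply/funext => n; rewrite /series /= mulr_sumr.
by apply: cvgP; apply: cvgMr mu_sum.
Qed.

Lemma mean_unique (f : G -> R) l :
  (series (rterm (fun g => mu g * f g)) @ \oo --> l)%classic -> mean f = l.
Proof. exact: cvg_lim. Qed.

Lemma mean_cst c : mean (fun=> c) = c.
Proof.
apply: mean_unique; rewrite -[X in (_ --> X)%classic]mulr1.
have -> : series (rterm (fun g => mu g * c)) = (fun n => c * series (rterm mu) n).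
  apply/funext => n; rewrite /series /= mulr_sumr; apply: eq_bigr => i _.
  by rewrite /rterm; case: pickle_inv => [g|]; rewrite ?mulr0 // mulrC.
exact: cvgMr mu_sum.
Qed.

Lemma mean_lin a b (f h : G -> R) c d : (forall g, `|f g| <= c) -> (forall g, `|h g| <= d) ->
  mean (fun g => a * f g + b * h g) = a * mean f + b * mean h.
Proof.
move=> fc hd; apply: mean_unique.
have -> : series (rterm (fun g => mu g * (a * f g + b * h g))) =
   (fun n => a * series (rterm (fun g => mu g * f g)) n
           + b * series (rterm (fun g => mu g * h g)) n).
  apply/funext => n; rewrite /series /= !mulr_sumr -big_split; apply: eq_bigr => i _ /=.
  by rewrite /rterm; case: pickle_inv => [g|]; rewrite ?mulr0 ?addr0 //; ring.
by apply: cvgD; apply: cvgMr; [exact: mean_cvg fc | exact: mean_cvg hd].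
Qed.

Lemma le_series_mean (f : G -> R) c N : (forall g, 0 <= f g <= c) ->
  series (rterm (fun g => mu g * f g)) N <= mean f.
Proof.
move=> fc; apply: nondecreasing_cvgn_le => [|].
  apply: nondecreasing_series => n _ _; rewrite /rterm; case: pickle_inv => [g|//].
  by rewrite mulr_ge0 //; case/andP: (fc g).
apply: cvgP; apply: (@mean_cvg f c) => g.
by case/andP: (fc g) => f0 fle; rewrite ger0_norm.
Qed.

Lemma mean_rsub s (f : G -> R) c : (forall g, `|f g| <= c) ->
  mean (fun g => s - f g) = s - mean f.
Proof.
move=> fc; rewrite -[s in RHS]mean_cst -[mean (fun=> s)]mul1r -mulN1r.
rewrite -(@mean_lin _ _ _ _ `|s| c) //; congr mean; apply/funext => g; ring.
Qed.

(** The function [s - f] is nonnegative, so its mean is at least its single term at [g]. This is the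
    source of every mixture estimate below. *)
Lemma mean_le_mix (f : G -> R) c s g : (forall h, `|f h| <= c) -> (forall h, f h <= s) ->
  mean f <= mu g * f g + (1 - mu g) * s.
Proof.
move=> fc fs.
suff: mu g * (s - f g) <= s - mean f by lra.
(* Stopping just after index [pickle g] makes the term at [g] the last one of the partial sum; the
   earlier terms are nonnegative. *)
rewrite -(mean_rsub s fc); apply: le_trans (@le_series_mean _ (s + c) (pickle g).+1 _); last first.
  move=> h; rewrite subr_ge0 fs lerD2l; apply: le_trans (ler_norm _) _.
  by rewrite normrN.
rewrite /series /= big_nat_recr //= {2}/rterm pickleK_inv lerDr sumr_ge0 // => i _.
by rewrite /rterm; case: pickle_inv => // h; rewrite mulr_ge0 // subr_ge0.
Qed.

Lemma series_rterm_sub s (f : G -> R) N : series (rterm (fun g => mu g * (s - f g))) N =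
  s * series (rterm mu) N - series (rterm (fun g => mu g * f g)) N.
Proof.
rewrite /series /= mulr_sumr -sumrB; apply: eq_bigr => i _.
by rewrite /rterm; case: pickle_inv => [g|]; rewrite ?mulr0 ?subr0 //; ring.
Qed.

(** Partial sums of the nonnegative functions [c - f] and [c + f] lie below their means, which
    bounds the tail from both sides by [c] times the mass not yet summed. *)
Lemma mean_tail (f : G -> R) c N : (forall g, `|f g| <= c) ->
  `|mean f - series (rterm (fun g => mu g * f g)) N| <= c * (1 - series (rterm mu) N).
Proof.
move=> fc.
have up (h : G -> R) : (forall g, `|h g| <= c) ->
    mean h - series (rterm (fun g => mu g * h g)) N <= c * (1 - series (rterm mu) N).
  move=> hc.
  have : series (rterm (fun g => mu g * (c - h g))) N <= mean (fun g => c - h g).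
    apply: (@le_series_mean _ (c + c)) => g.
    by have := hc g; rewrite ler_norml => /andP[? ?]; lra.
  by rewrite (mean_rsub c hc) series_rterm_sub; lra.
rewrite ler_norml up // andbT.
(* Writing [0 - f] for the opposite lets the rules for [s - f] apply with [s = 0]. *)
have Nfc g : `|0 - f g| <= c by rewrite sub0r normrN.
by have := up _ Nfc; rewrite (mean_rsub 0 fc) series_rterm_sub; lra.
Qed.

(** The tail estimate at [N = 0], where the partial sums are empty. *)
Lemma mean_norm_le (f : G -> R) c : (forall g, `|f g| <= c) -> `|mean f| <= c.
Proof.
move=> fc; have := mean_tail 0 fc.
by rewrite /series /= !big_geq // !subr0 mulr1.
Qed.

(** Fubini for bounded functions: a finite partial sum over [g] commutes with the mean over [h] by
    linearity, and the remainder is at most [c] times the remaining mass, uniformly in [h], hence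
    tends to 0. *)
Lemma mean_swap (F : G -> G -> R) c : (forall g h, `|F g h| <= c) ->
  mean (fun g => mean (F g)) = mean (fun h => mean (F^~ h)).
Proof.
move=> Fc.
pose S N h := series (rterm (fun g => mu g * F g h)) N.
have Sc N h : `|S N h| <= c * series (rterm mu) N.
  rewrite /S /series /= mulr_sumr; apply: le_trans (ler_norm_sum _ _ _) _.
  by apply: ler_sum => i _; apply: rtermM_bound.
have Smean N : series (rterm (fun g => mu g * mean (F g))) N = mean (S N).
  elim: N => [|N IH].
    rewrite /series /= big_geq // -[LHS]mean_cst; congr mean.
    by apply/funext => h; rewrite /S /series /= big_geq.
  rewrite /series /= big_nat_recr //= [X in X + _]IH /rterm.
  case E: (pickle_inv N) => [g|].
    rewrite -[mean (S N)]mul1r -(@mean_lin _ _ _ _ (c * series (rterm mu) N) c) //.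
    congr mean; apply/funext => h.
    by rewrite /S /series /= big_nat_recr //= [rterm _ N]/rterm E mul1r.
  rewrite addr0; congr mean; apply/funext => h.
  by rewrite /S /series /= big_nat_recr //= [rterm _ N]/rterm E addr0.
apply: mean_unique; apply/cvgrPdist_le => e e0.
have tail0 : ((fun N => c * (1 - series (rterm mu) N)) @ \oo --> c * (1 - 1))%classic.
  by apply: cvgMr; apply: cvgB mu_sum; apply: cvg_cst.
rewrite subrr mulr0 in tail0.
move/cvgrPdist_le/(_ e e0): tail0; apply: filterS => N.
rewrite sub0r normrN; apply: le_trans; apply: le_trans (ler_norm _).
rewrite Smean.
have -> : mean (fun h => mean (F^~ h)) - mean (S N) = mean (fun h => mean (F^~ h) - S N h).
  rewrite -[X in X - _]mul1r -mulN1r.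
  rewrite -(@mean_lin _ _ _ _ c (c * series (rterm mu) N)) //.
    by congr mean; apply/funext => h; ring.
  by move=> h; apply: mean_norm_le.
by apply: mean_norm_le => h; apply: mean_tail.
Qed.

End Mean.

(** * Commuting averaging operators and their joint fixed points *)

Section Averaging.
Variables (R : realType) (G : countGroupType) (mu : G -> R) (hmu : symmetric_prob mu).
Variables (X : Type).
Implicit Types (phi psi : G -> X -> X) (f : X -> R).

(** The family [phi] stays abstract so that left and right diagonal translations of [G * G] are both
    instances. *)
Definition avg phi f (x : X) : R := mean mu (fun g => f (phi g x)).

Lemma prob_le1 g : mu g <= 1.
Proof.
(* For minus the indicator of [g], the mixture bound with [s = 0] puts the mean below [- mu g],
   while the norm bound keeps it above -1. *)
pose f h : R := - (h == g)%:R.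
have fb h : `|f h| <= 1 by rewrite /f normrN; case: eqP; rewrite ?normr1 ?normr0.
have f0 h : f h <= 0 by rewrite /f; case: eqP; rewrite ?oppr0 ?lerN10.
have := mean_le_mix hmu g fb f0; have := mean_norm_le hmu fb.
by rewrite ler_norml => /andP[? _]; rewrite /f eqxx mulr1n; lra.
Qed.

Lemma prob_gt0 : exists g, 0 < mu g.
Proof.
case: (hmu) => mu0 _; apply: contrapT => /forallNP noG.
have f0 : mean mu (fun=> 1) = 0.
  apply: mean_unique; rewrite (_ : series _ = fun=> 0); first exact: cvg_cst.
  apply/funext => n; rewrite /series /= big1 // => i _; rewrite /rterm.
  case: pickle_inv => // g; have /negP := noG g.
  by rewrite lt_neqAle mu0 andbT negbK => /eqP <-; rewrite mul0r.
by move: f0; rewrite mean_cst // => /eqP; rewrite oner_eq0.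
Qed.

Lemma avg_norm_le phi f c : (forall x, `|f x| <= c) -> forall x, `|avg phi f x| <= c.
Proof. by move=> fc x; apply: mean_norm_le. Qed.

Lemma avg_lin phi a b f h c d : (forall x, `|f x| <= c) -> (forall x, `|h x| <= d) ->
  avg phi (fun x => a * f x + b * h x) = (fun x => a * avg phi f x + b * avg phi h x).
Proof. by move=> fc hd; apply/funext => x; apply: mean_lin. Qed.

Lemma avg_comm phi psi f c : (forall g h x, phi g (psi h x) = psi h (phi g x)) ->
  (forall x, `|f x| <= c) -> avg phi (avg psi f) = avg psi (avg phi f).
Proof.
move=> comm fc; apply/funext => x.
rewrite /avg (mean_swap hmu (fun g h => fc _)).
by congr mean; apply/funext => h; congr mean; apply/funext => g; rewrite comm.
Qed.

(* By symmetry the two-step walk returns to its start with probability at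
   least [mu g ^+ 2], so its averaging operator is a proper mixture with the
   identity. *)
Lemma avg2_le_mix phi f c s g x : (forall h y, phi h^-1%g (phi h y) = y) ->
  (forall y, `|f y| <= c) -> (forall y, f y <= s) ->
  avg phi (avg phi f) x <= mu g ^+ 2 * f x + (1 - mu g ^+ 2) * s.
Proof.
move=> phiK fc fs.
have step y h : avg phi f y <= mu h * f (phi h y) + (1 - mu h) * s.
  exact: (mean_le_mix hmu h (fun k => fc (phi k y)) (fun k => fs (phi k y))).
have avg_s y : avg phi f y <= s.
  case: (hmu) => mu0 _; have := ler_wpM2l (mu0 g) (fs (phi g y)).
  by have := step y g; lra.
have := mean_le_mix hmu g (fun k => avg_norm_le phi fc (phi k x)) (fun k => avg_s (phi k x)).
have := step (phi g x) g^-1%g; rewrite phiK -[avg phi (avg phi f) x]/(mean mu _).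
case: (hmu) => mu0 [_ <-] le1 le2; apply: le_trans le2 _.
by have := ler_wpM2l (mu0 g) le1; lra.
Qed.

(** Along the iterates [T n] of the squared [psi]-average, the squared [phi]-average steps backward,
    so the mixture bound for the latter is exactly a backward drift with [a = mu g ^+ 2]. *)
Lemma avg_harmonic_le phi psi f c : (forall g h x, phi g (psi h x) = psi h (phi g x)) ->
  (forall h y, phi h^-1%g (phi h y) = y) -> (forall x, `|f x| <= c) ->
  avg phi (avg psi f) = f -> forall x, f x <= avg psi (avg psi f) x.
Proof.
move=> comm phiK fc fix_f.
pose T n := iter n (fun h => avg psi (avg psi h)) f.
have Tc n x : `|T n x| <= c.
  by elim: n x => //= n IH; apply: avg_norm_le; apply: avg_norm_le.
have fix_T n : avg phi (avg psi (T n)) = T n.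
  elim: n => //= n IH; rewrite (avg_comm comm (avg_norm_le psi (avg_norm_le psi (Tc n)))).
  by rewrite (avg_comm comm (avg_norm_le psi (Tc n))) IH.
have back n : avg phi (avg phi (T n.+1)) = T n.
  by rewrite /= (avg_comm comm (avg_norm_le psi (Tc n))) !fix_T.
have [g g0] := prob_gt0.
move=> x0; apply: (@backward_drift_le0 _ _ c (mu g ^+ 2) T _ Tc _ 0 x0) => [|s Ds n x].
  by rewrite exprn_gt0 //= expr_le1 ?prob_le1 // ltW.
(* The coefficients 1 and -1 put the difference in the shape required by [avg_lin]. *)
have Dc y : `|1 * T n.+1 y + (-1) * T n.+2 y| <= c + c.
  rewrite mul1r mulN1r; exact: le_trans (ler_normB _ _) (lerD _ _).
have Ds' y : 1 * T n.+1 y + (-1) * T n.+2 y <= s by rewrite mul1r mulN1r.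
have := avg2_le_mix g x phiK Dc Ds'.
rewrite (avg_lin _ _ _ (Tc n.+1) (Tc n.+2)).
rewrite (avg_lin _ _ _ (avg_norm_le phi (Tc n.+1)) (avg_norm_le phi (Tc n.+2))).
by rewrite !back !mul1r !mulN1r.
Qed.

Lemma avg_harmonic phi psi f c : (forall g h x, phi g (psi h x) = psi h (phi g x)) ->
  (forall h y, phi h^-1%g (phi h y) = y) -> (forall x, `|f x| <= c) ->
  avg phi (avg psi f) = f -> avg phi f = avg psi f /\ avg psi (avg psi f) = f.
Proof.
move=> comm phiK fc fix_f.
have Nfc x : `|- f x| <= c by rewrite normrN.
have avgN phi' h : (forall x, `|h x| <= c) ->
    avg phi' (fun x => - h x) = (fun x => - avg phi' h x).
  move=> hc; have := avg_lin phi' (-1) 0 hc hc.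
  by under [X in avg _ X]eq_fun do rewrite mulN1r mul0r addr0;
     under [X in _ = X]eq_fun do rewrite mulN1r mul0r addr0.
have psi2 : avg psi (avg psi f) = f.
  apply/funext => x; apply/eqP; rewrite eq_le (avg_harmonic_le comm phiK fc fix_f) andbT.
  rewrite -lerN2; have := avg_harmonic_le comm phiK Nfc _ x.
  by rewrite !avgN ?fix_f //; [apply | apply: avg_norm_le..].
(* With A and B the [phi]- and [psi]-averages: B f = B (A B f) = A (B^2 f) = A f. *)
by split=> //; rewrite -[in RHS]fix_f -(avg_comm comm (avg_norm_le psi fc)) psi2.
Qed.

End Averaging.

(** * Complex means, reduced to real and imaginary parts *)

Section ComplexMean.
Variables (R : realType) (G : countGroupType) (mu : G -> R) (hmu : symmetric_prob mu).
Local Notation C := (CC R).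

Definition cmean (z : G -> C) : C := gsum (fun g => (mu g)%:C%C * z g).

Lemma cvg_complex (a b : nat -> R) (x y : R) :
  (a @ \oo --> x)%classic -> (b @ \oo --> y)%classic ->
  ((fun n => Complex (a n) (b n) : C) @ \oo --> (Complex x y : C))%classic.
Proof.
move=> ax bx; apply/cvgrPdist_le => e e0.
(* The radius [e] lives in [C], where being positive means having zero imaginary part and positive
   real part. *)
have /andP[/eqP Ime Ree] : (complex.Im e == 0) && (0 < complex.Re e).
  by move: e0; rewrite ltcE.
have e2 : 0 < complex.Re e / 2 by rewrite divr_gt0.
move/cvgrPdist_le/(_ _ e2): bx; move/cvgrPdist_le/(_ _ e2): ax.
apply: filterS2 => n an bn.
have -> : (Complex x y : C) - Complex (a n) (b n) =
    (x - a n)%:C%C + 'i%C * (y - b n)%:C%C.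
  by apply/eqP; rewrite eq_complex /= !mul0r mulr0 mul1r subr0 !add0r !addr0 !eqxx.
apply: le_trans (ler_normD _ _) _.
rewrite normrM !normc_def /= !expr0n expr1n /= !addr0 add0r sqrtr1 mul1r !sqrtr_sqr.
by rewrite lecE /= addr0 Ime eqxx /=; lra.
Qed.

Definition cbounded (z : G -> C) := exists c : R, forall g, `|z g| <= c%:C%C.

Lemma le_Re_norm (z : C) (c : R) : `|z| <= c%:C%C -> `|complex.Re z| <= c.
Proof. by move=> zc; rewrite -lecR; apply: le_trans zc; apply: normc_ge_Re. Qed.

Lemma le_Im_norm (z : C) (c : R) : `|z| <= c%:C%C -> `|complex.Im z| <= c.
Proof.
move=> zc; rewrite -normrN -(ReiNIm z); apply: le_Re_norm.
by rewrite normrM [`|'i%C|]normc_def /= expr0n expr1n add0r sqrtr1 mulr1.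
Qed.

(** The weights are real, so partial sums split coordinatewise; boundedness makes both coordinate
    series converge, which identifies the complex limit. *)
Lemma cmeanE (z : G -> C) : cbounded z ->
  cmean z = Complex (mean mu (fun g => complex.Re (z g))) (mean mu (fun g => complex.Im (z g))).
Proof.
move=> [c zc]; apply: cvg_lim => //.
have -> : series (gterm (fun g => (mu g)%:C%C * z g)) = (fun n => Complex
    (series (rterm (fun g => mu g * complex.Re (z g))) n)
    (series (rterm (fun g => mu g * complex.Im (z g))) n)).
  apply/funext => n; rewrite /series /=; elim: n => [|n IH]; first by rewrite !big_geq.
  rewrite !big_nat_recr //= IH /gterm /rterm; case: pickle_inv => [g|].
    by case: (z g) => p q; apply/eqP; rewrite eq_complex /= !mul0r subr0 addr0 !eqxx.
  by rewrite !addr0.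
apply: cvg_complex; apply: mean_cvg => // g; [exact: le_Re_norm | exact: le_Im_norm].
Qed.

Lemma cboundedD (z w : G -> C) : cbounded z -> cbounded w -> cbounded (fun g => z g + w g).
Proof.
move=> [c zc] [d wd]; exists (c + d) => g; rewrite rmorphD.
exact: le_trans (ler_normD _ _) (lerD _ _).
Qed.

Lemma cboundedM a (z : G -> C) : cbounded z -> cbounded (fun g => a * z g).
Proof.
move=> [c zc]; exists (complex.Re `|a| * c) => g.
have aE : `|a| = (complex.Re `|a|)%:C%C by rewrite RRe_real ?normr_real.
by rewrite rmorphM /= -aE normrM ler_wpM2l.
Qed.

Lemma cmeanD (z w : G -> C) : cbounded z -> cbounded w ->
  cmean (fun g => z g + w g) = cmean z + cmean w.
Proof.
move=> zb wb; rewrite !cmeanE //; last exact: cboundedD.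
move: zb wb => [c zc] [d wd].
apply/eqP; rewrite eq_complex /=; apply/andP; split; apply/eqP.
  rewrite -[X in X + _]mul1r -[X in _ + X]mul1r.
  rewrite -(mean_lin hmu _ _ (fun g => le_Re_norm (zc g)) (fun g => le_Re_norm (wd g))).
  by congr mean; apply/funext => g; rewrite !mul1r raddfD.
rewrite -[X in X + _]mul1r -[X in _ + X]mul1r.
rewrite -(mean_lin hmu _ _ (fun g => le_Im_norm (zc g)) (fun g => le_Im_norm (wd g))).
by congr mean; apply/funext => g; rewrite !mul1r raddfD.
Qed.

Lemma cmeanM a (z : G -> C) : cbounded z -> cmean (fun g => a * z g) = a * cmean z.
Proof.
move=> zb; rewrite !cmeanE //; last exact: cboundedM.
move: zb => [c zc]; case: a => p q.
have lin := mean_lin hmu _ _ (fun g => le_Re_norm (zc g)) (fun g => le_Im_norm (zc g)).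
apply/eqP; rewrite eq_complex /= -mulNr -!lin [X in _ && (_ == X)]addrC -lin.
by apply/andP; split; apply/eqP; congr mean; apply/funext => g; case: (z g) => ? ? /=; ring.
Qed.

Lemma cbounded_sum (I : Type) (s : seq I) (z : I -> G -> C) : (forall i, cbounded (z i)) ->
  cbounded (fun g => \sum_(i <- s) z i g).
Proof.
move=> zb; elim: s => [|i s IH].
  by exists 0 => g; rewrite big_nil normr0.
have [c ic] := cboundedD (zb i) IH.
by exists c => g; rewrite big_cons.
Qed.

Lemma cmean_sum (I : Type) (s : seq I) (z : I -> G -> C) : (forall i, cbounded (z i)) ->
  cmean (fun g => \sum_(i <- s) z i g) = \sum_(i <- s) cmean (z i).
Proof.
move=> zb; elim: s => [|i s IH].
  rewrite big_nil -[RHS](mul0r (cmean (fun=> 0))) -cmeanM; last by exists 0 => g; rewrite normr0.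
  by congr cmean; apply/funext => g; rewrite big_nil mul0r.
rewrite big_cons -IH -cmeanD //; last exact: cbounded_sum.
by congr cmean; apply/funext => g; rewrite big_cons.
Qed.

(* With [a +i* b] the mean, [a^2 + b^2 = mean (a Re z + b Im z)], and
   Cauchy-Schwarz bounds the integrand by [|a +i* b| k]. *)
Lemma cmean_norm_le (z : G -> C) (k : C) : (forall g, `|z g| <= k) -> `|cmean z| <= k.
Proof.
move=> zk.
(* As [k] bounds the modulus at the identity of the group, it is nonnegative, hence real, and its
   real part can replace it. *)
have k0 : 0 <= k := le_trans (normr_ge0 _) (zk 1%g).
have kE : k = (complex.Re k)%:C%C by rewrite RRe_real // ger0_real.
have zc g : `|z g| <= (complex.Re k)%:C%C by rewrite -kE.
rewrite kE in k0 *; move: k0; rewrite ler0c; move: (complex.Re k) zc => c {}zc c0.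
rewrite cmeanE; last by exists c.
set a := mean _ _; set b := mean _ _.
have lin := mean_lin hmu a b (fun g => le_Re_norm (zc g)) (fun g => le_Im_norm (zc g)).
set r := Num.sqrt (a ^+ 2 + b ^+ 2).
have r2 : r ^+ 2 = a ^+ 2 + b ^+ 2 by rewrite sqr_sqrtr // addr_ge0 // sqr_ge0.
have r0 : 0 <= r by exact: sqrtr_ge0.
rewrite normc_def /= lecR -/r.
have : `|mean mu (fun g => a * complex.Re (z g) + b * complex.Im (z g))| <= r * c.
  apply: (mean_norm_le hmu) => g.
  have := zc g; rewrite normc_def lecR; move: (complex.Re _) (complex.Im _) => p q pqc.
  have pq2 : p ^+ 2 + q ^+ 2 <= c ^+ 2.
    rewrite -[leLHS]sqr_sqrtr ?addr_ge0 ?sqr_ge0 //.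
    by rewrite ler_pXn2r ?nnegrE // sqrtr_ge0.
  rewrite -(ler_pXn2r (n := 2)) ?nnegrE // ?mulr_ge0 //.
  rewrite real_normK ?num_real // exprMn r2.
  have : (a * p + b * q) ^+ 2 <= (a ^+ 2 + b ^+ 2) * (p ^+ 2 + q ^+ 2).
    by rewrite -subr_ge0 [X in 0 <= X](_ : _ = (a * q - b * p) ^+ 2) ?sqr_ge0 //; ring.
  by move/le_trans; apply; rewrite ler_wpM2l // addr_ge0 // sqr_ge0.
rewrite lin -/a -/b -!expr2 -r2 ger0_norm ?sqr_ge0 // expr2.
by have [-> //|rn0] := eqVneq r 0; rewrite ler_pM2l // lt_neqAle eq_sym rn0.
Qed.

End ComplexMean.

(** * Bounded operators and the action of [Pmu] and [Pomu] on them *)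

Section Operators.
Variables (R : realType) (G : countGroupType) (mu : G -> R) (hmu : symmetric_prob mu).
Local Notation C := (CC R).
Implicit Types (S T : opmat R G).

Definition form T (s : seq G) (u v : G -> C) : C :=
  \sum_(x <- s) \sum_(y <- s) (u x)^* * T x y * v y.

Definition sqnorm (s : seq G) (u : G -> C) : C := \sum_(x <- s) `|u x| ^+ 2.

Lemma sqnorm_ge0 s u : 0 <= sqnorm s u.
Proof. by apply: sumr_ge0 => x _; rewrite exprn_ge0. Qed.

(** Taking square roots makes the bound linear in [c], so that the triangle inequality and
    [cmean_norm_le] apply to forms directly. *)
Lemma bounded_opP T : bounded_op T <-> exists c : C, 0 <= c /\ forall s u v, uniq s ->
  `|form T s u v| <= c * sqrtC (sqnorm s u * sqnorm s v).
Proof.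
have sqE (c : C) s u v : c ^+ 2 * sqnorm s u * sqnorm s v =
    (c * sqrtC (sqnorm s u * sqnorm s v)) ^+ 2.
  by rewrite exprMn sqrtCK mulrA.
have ge (c : C) s u v : 0 <= c -> 0 <= c * sqrtC (sqnorm s u * sqnorm s v).
  by move=> c0; rewrite mulr_ge0 // sqrtC_ge0 mulr_ge0 // sqnorm_ge0.
split=> -[c [c0 Tc]]; exists c; split=> // s u v us.
  by rewrite -(ler_pXn2r (n := 2)) ?nnegrE ?ge // -sqE; apply: Tc.
rewrite -/(form T s u v) -/(sqnorm s u) -/(sqnorm s v) sqE.
by rewrite ler_pXn2r ?nnegrE ?ge //; apply: Tc.
Qed.

Lemma bounded_op_entry T : bounded_op T -> exists c : R, forall x y, `|T x y| <= c%:C%C.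
Proof.
move=> /bounded_opP [c [c0 Tc]]; exists (complex.Re c) => x y.
rewrite RRe_real ?ger0_real //.
(* Testing against the delta vectors at [x] and [y] isolates one entry; [undup] covers the case
   [x = y]. *)
pose s := undup [:: x; y]; have us : uniq s := undup_uniq _.
have xs : x \in s by rewrite mem_undup !inE eqxx.
have ys : y \in s by rewrite mem_undup !inE eqxx orbT.
pose d z (w : G) : C := (w == z)%:R.
have norm_d z : z \in s -> sqnorm s (d z) = 1.
  move=> zs; rewrite /sqnorm (bigD1_seq z) //= /d eqxx normr1 expr1n big1 ?addr0 // => w.
  by move=> /negPf ->; rewrite normr0 expr0n.
have := Tc s (d x) (d y) us; rewrite !norm_d // mulr1 sqrtC1 mulr1.
rewrite /form (bigD1_seq x) //= [X in _ + X]big1 ?addr0 => [|w /negPf wx]; last first.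
  by apply: big1 => z _; rewrite /d wx conjC0 !mul0r.
rewrite (bigD1_seq y) //= [X in _ + X]big1 ?addr0 => [|w /negPf wy]; last first.
  by rewrite /d wy mulr0.
by rewrite /d !eqxx conjC1 mul1r mulr1.
Qed.

Lemma bounded_op_lin (a b : C) S T : bounded_op S -> bounded_op T ->
  bounded_op (fun x y => a * S x y + b * T x y).
Proof.
move=> /bounded_opP [c [c0 Sc]] /bounded_opP [d [d0 Td]]; apply/bounded_opP.
exists (`|a| * c + `|b| * d); split=> [|s u v us].
  by rewrite addr_ge0 // mulr_ge0.
have -> : form (fun x y => a * S x y + b * T x y) s u v = a * form S s u v + b * form T s u v.
  rewrite /form !mulr_sumr -big_split; apply: eq_bigr => x _.
  by rewrite !mulr_sumr -big_split; apply: eq_bigr => y _ /=; ring.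
apply: le_trans (ler_normD _ _) _; rewrite !normrM mulrDl -!mulrA.
by apply: lerD; rewrite ler_wpM2l //; [apply: Sc | apply: Td].
Qed.

(** The form of [Pmu mu T] is a mean of forms of [T] at translated vectors. Translation preserves
    norms, so each of these forms obeys the bound of [T] with the same constant, and so does their
    mean. *)
Lemma bounded_op_Pmu T : bounded_op T -> bounded_op (Pmu mu T).
Proof.
move=> Tb; have [e Te] := bounded_op_entry Tb.
have [c [c0 Tc]] := (bounded_opP T).1 Tb.
apply/bounded_opP; exists c; split=> // s u v us.
have -> : form (Pmu mu T) s u v = cmean mu (fun g =>
    \sum_(x <- s) \sum_(y <- s) ((u x)^* * v y) * T (x * g)%g (y * g)%g).
  rewrite cmean_sum // => [|x]; last first.
    by apply: cbounded_sum => y; apply: cboundedM; exists e => g; apply: Te.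
  apply: eq_bigr => x _; rewrite cmean_sum // => [|y]; last first.
    by apply: cboundedM; exists e => g; apply: Te.
  apply: eq_bigr => y _; rewrite cmeanM //; last by exists e => g; apply: Te.
  by rewrite mulrAC.
apply: (cmean_norm_le hmu) => g.
(* Support and vectors are moved together: [tr w] takes at [x * g] the value of [w] at [x]. *)
pose sg := [seq (x * g)%g | x <- s].
pose tr (w : G -> C) x := w (x * g^-1)%g.
have sqnorm_tr w : sqnorm sg (tr w) = sqnorm s w.
  by rewrite /sqnorm big_map; apply: eq_bigr => x _; rewrite /tr mulgK.
have usg : uniq sg by rewrite map_inj_uniq //; apply: mulIg.
have := Tc sg (tr u) (tr v) usg; rewrite !sqnorm_tr; congr (`|_| <= _).
rewrite /form big_map; apply: eq_bigr => x _.
by rewrite big_map; apply: eq_bigr => y _; rewrite /tr !mulgK mulrAC.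
Qed.

Lemma Pmu_lin (a b : C) S T : bounded_op S -> bounded_op T ->
  Pmu mu (fun x y => a * S x y + b * T x y) = (fun x y => a * Pmu mu S x y + b * Pmu mu T x y).
Proof.
move=> /bounded_op_entry [c Sc] /bounded_op_entry [d Td].
apply/funext => x; apply/funext => y.
have Sb : cbounded (fun g => S (x * g)%g (y * g)%g) by exists c => g.
have Tb : cbounded (fun g => T (x * g)%g (y * g)%g) by exists d => g.
rewrite -[LHS]/(cmean mu _) (cmeanD hmu (cboundedM a Sb) (cboundedM b Tb)).
by rewrite !cmeanM.
Qed.

Lemma Pomu_lin (a b : C) S T : bounded_op S -> bounded_op T ->
  Pomu mu (fun x y => a * S x y + b * T x y) = (fun x y => a * Pomu mu S x y + b * Pomu mu T x y).
Proof.
move=> /bounded_op_entry [c Sc] /bounded_op_entry [d Td].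
apply/funext => x; apply/funext => y.
have Sb : cbounded (fun g => S (g * x)%g (g * y)%g) by exists c => g.
have Tb : cbounded (fun g => T (g * x)%g (g * y)%g) by exists d => g.
rewrite -[LHS]/(cmean mu _) (cmeanD hmu (cboundedM a Sb) (cboundedM b Tb)).
by rewrite !cmeanM.
Qed.

(** Viewing a matrix as a function on [G * G], these diagonal translations turn [Pmu] and [Pomu]
    into [avg mu rmul] and [avg mu lmul] on real and imaginary parts. They commute by
    associativity. *)
Let rmul (g : G) (p : G * G) := (p.1 * g, p.2 * g)%g.
Let lmul (g : G) (p : G * G) := (g * p.1, g * p.2)%g.

(** The averages have real weights, so the fixed-point equation holds separately for the real and
    imaginary parts of the entries, and [avg_harmonic] applies to each. *)
Lemma Pmu_Pomu_fixed T : bounded_op T -> Pmu mu (Pomu mu T) = T ->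
  Pmu mu T = Pomu mu T /\ Pomu mu (Pomu mu T) = T.
Proof.
move=> /bounded_op_entry [c Tc] fixT.
have Pb (phi : G -> G -> G) x y : cbounded (fun g => T (phi g x) (phi g y)) by exists c => g.
have Pomu_b x y : `|Pomu mu T x y| <= c%:C%C by apply: (cmean_norm_le hmu) => g.
have POb (phi : G -> G -> G) x y : cbounded (fun g => Pomu mu T (phi g x) (phi g y)).
  by exists c => g.
have comm g h p : rmul g (lmul h p) = lmul h (rmul g p) by rewrite /rmul /lmul /= !mulgA.
have rmulK h p : rmul h^-1%g (rmul h p) = p.
  by case: p => x y; rewrite /rmul /= !mulgK.
pose re p := complex.Re (T p.1 p.2); pose im p := complex.Im (T p.1 p.2).
have re_c p : `|re p| <= c by apply: le_Re_norm.
have im_c p : `|im p| <= c by apply: le_Im_norm.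
have PmuE x y : Pmu mu T x y = Complex (avg mu rmul re (x, y)) (avg mu rmul im (x, y)).
  exact: (cmeanE hmu (Pb (fun g x => (x * g)%g) x y)).
have PomuE x y : Pomu mu T x y = Complex (avg mu lmul re (x, y)) (avg mu lmul im (x, y)).
  exact: (cmeanE hmu (Pb (fun g x => (g * x)%g) x y)).
have PPE x y : T x y = Complex (avg mu rmul (avg mu lmul re) (x, y))
    (avg mu rmul (avg mu lmul im) (x, y)).
  rewrite -[in LHS]fixT [LHS](cmeanE hmu (POb (fun g x => (x * g)%g) x y)).
  by congr Complex; congr mean; apply/funext => g; rewrite PomuE.
have OOE x y : Pomu mu (Pomu mu T) x y = Complex (avg mu lmul (avg mu lmul re) (x, y))
    (avg mu lmul (avg mu lmul im) (x, y)).
  rewrite [LHS](cmeanE hmu (POb (fun g x => (g * x)%g) x y)).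
  by congr Complex; congr mean; apply/funext => g; rewrite PomuE.
have fix_re : avg mu rmul (avg mu lmul re) = re.
  by apply/funext => -[x y]; rewrite /re /= PPE.
have fix_im : avg mu rmul (avg mu lmul im) = im.
  by apply/funext => -[x y]; rewrite /im /= PPE.
have [eq_re fix2_re] := avg_harmonic hmu comm rmulK re_c fix_re.
have [eq_im fix2_im] := avg_harmonic hmu comm rmulK im_c fix_im.
split; apply/funext => x; apply/funext => y.
  by rewrite PmuE PomuE eq_re eq_im.
by rewrite OOE fix2_re fix2_im /re /im /=; case: (T x y).
Qed.

End Operators.

(** * The decomposition and its uniqueness *)

Theorem theorem3p3 (R : realType) (G : countGroupType) (mu : G -> R)
  (T : opmat R G) :
  symmetric_prob mu ->
  bounded_op T ->
  Pmu mu (Pomu mu T) = T ->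
  exists! T01 : opmat R G * opmat R G,
    [/\ bounded_op T01.1, bounded_op T01.2,
        (forall x y, T x y = T01.1 x y + T01.2 x y),
        Pmu mu T01.1 = T01.1 /\ Pomu mu T01.1 = T01.1 &
        Pmu mu T01.2 = (fun x y => - T01.2 x y) /\
        Pomu mu T01.2 = (fun x y => - T01.2 x y)].
Proof.
move=> hmu Tb fixT.
have [PT OOT] := Pmu_Pomu_fixed hmu Tb fixT.
have Pb := bounded_op_Pmu hmu Tb.
have POT : Pomu mu (Pmu mu T) = T by rewrite PT.
have PPT : Pmu mu (Pmu mu T) = T by rewrite PT.
pose h : CC R := 2^-1.
have hh : h + h = 1 by rewrite /h -mulr2n -[_ *+ 2]mulr_natl mulfV ?pnatr_eq0.
(* Half the sum and half the difference of [T] and [Pmu mu T]. *)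
exists (fun x y => h * T x y + h * Pmu mu T x y, fun x y => h * T x y + - h * Pmu mu T x y).
split=> [|[T0 T1] /= [T0b T1b T01 [PT0 _] [PT1 _]]].
  split=> /=; try exact: bounded_op_lin.
  - by move=> x y; rewrite mulNr addrACA subrr addr0 -mulrDl hh mul1r.
  (* Both operators exchange [T] and [Pmu mu T]: they fix the half sum and, in the next case, negate
     the half difference. *)
  - rewrite Pmu_lin // Pomu_lin // PPT POT -PT.
    by split; apply/funext => x; apply/funext => y; rewrite addrC.
  - rewrite Pmu_lin // Pomu_lin // PPT POT -PT.
    by split; apply/funext => x; apply/funext => y; rewrite !mulNr opprB.
have TE : T = (fun x y => 1 * T0 x y + 1 * T1 x y).
  by apply/funext => x; apply/funext => y; rewrite !mul1r T01.
(* For any competing pair, [T] is the sum and [Pmu mu T] the difference of its components, and these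
   two equations determine both. *)
have PTE x y : Pmu mu T x y = T0 x y - T1 x y.
  by rewrite {1}TE Pmu_lin // PT0 PT1 !mul1r.
congr pair; apply/funext => x; apply/funext => y; rewrite PTE T01.
  by rewrite -[RHS]mul1r -hh; ring.
by rewrite -[RHS]mul1r -hh; ring.
Qed.
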